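(* Let $n \geq 1$ be an integer and let $q = 2^n$. Let $\mathrm{AGL}(2,q^2)$ be the affine group of pairs $(a,A)$ with $a \in \mathbb{F}_{q^2}^2$, $A \in \mathrm{GL}_2(\mathbb{F}_{q^2})$ and multiplication $(a,A)(b,B) = (a+Ab,AB)$, and let $$H_q = \{(b,\mathrm{I}_2) \in \mathrm{AGL}(2,q^2) \mid b \in \mathbb{F}_q^2\},$$ where $\mathbb{F}_q^2 \subseteq \mathbb{F}_{q^2}^2$ denotes the set of column vectors with both entries in the subfield $\mathbb{F}_q$ of $\mathbb{F}_{q^2}$. Then $H_q$ is a non-normal subgroup of $\mathrm{AGL}(2,q^2)$ which is a perfect code of $\mathrm{AGL}(2,q^2)$, but the property $\Phi(\mathrm{AGL}(2,q^2),H_q)$ does not hold.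
   Context: $\mathrm{I}_2$ is the $2\times 2$ identity matrix. The identity element of $\mathrm{AGL}(2,q^2)$ is $(0,\mathrm{I}_2)$. For a finite group $G$ with identity $e$ and a subset $S \subseteq G \setminus \{e\}$ that is inverse-closed (i.e. $x \in S$ implies $x^{-1}\in S$), the Cayley graph $\mathrm{Cay}(G,S)$ is the simple graph with vertex set $G$ in which $g,h \in G$ are adjacent if and only if $hg^{-1} \in S$. A subset $C$ of the vertex set of a graph $X$ is a perfect code of $X$ if $C$ is a coclique (independent set) of $X$ and every vertex of $X$ not in $C$ is adjacent to exactly one vertex in $C$. A subset (in particular, a subgroup) $C$ of a finite group $G$ is a perfect code of $G$ if there exists an inverse-closed subset $S \subseteq G\setminus\{e\}$ such that $C$ is a perfect code of $\mathrm{Cay}(G,S)$. For a finite group $G$ with identity $e$ and a subgroup $H \leq G$, the property $\Phi(G,H)$ is the statement: for all $g \in G$, if $g^2 \in H$ then there exists $h \in H$ such that $(gh)^2 = e$. *)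

(* Defs.v *)
From HB Require Import structures.
From mathcomp Require Import all_boot all_order all_algebra all_fingroup.

Set Implicit Arguments.
Unset Strict Implicit.
Unset Printing Implicit Defensive.

Import GRing.Theory.

Local Open Scope group_scope.

(* A finite group G is represented by a finGroupType, i.e. G is the whole     *)
(* type; subsets and subgroups of G are then elements of {set gT}.            *)

Definition inverse_closed (gT : finGroupType) (S : {set gT}) : Prop :=
  forall x, x \in S -> x^-1 \in S.

Definition cayley (gT : finGroupType) (S : {set gT}) : rel gT :=
  fun g h => h * g^-1 \in S.

Definition coclique (V : finType) (e : rel V) (C : {set V}) : Prop :=
  {in C &, forall u v, ~~ e u v}.

Definition perfect_code (V : finType) (e : rel V) (C : {set V}) : Prop :=
  coclique e C /\
  forall v, v \notin C -> exists! c, c \in C /\ e v c.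

Definition group_perfect_code (gT : finGroupType) (C : {set gT}) : Prop :=
  exists S : {set gT},
    [/\ 1 \notin S, inverse_closed S & perfect_code (cayley S) C].

Definition Phi (gT : finGroupType) (H : {set gT}) : Prop :=
  forall g : gT, g ^+ 2 \in H -> exists2 h, h \in H & (g * h) ^+ 2 = 1.

Record agl2 (F : finFieldType) : predArgType :=
  Agl2 { agl2_vec : 'cV[F]_2; agl2_lin : {'GL_2[F]} }.

Section AGL2.

Variable F : finFieldType.

Implicit Types x y z : agl2 F.

Definition pair_of_agl2 x := (agl2_vec x, agl2_lin x).
Definition agl2_of_pair (p : 'cV[F]_2 * {'GL_2[F]}) := Agl2 p.1 p.2.

Lemma pair_of_agl2K : cancel pair_of_agl2 agl2_of_pair.
Proof. by case. Qed.

HB.instance Definition _ := Finite.copy (agl2 F) (can_type pair_of_agl2K).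

Definition agl2_mul x y : agl2 F :=
  Agl2 (agl2_vec x + GLval (agl2_lin x) *m agl2_vec y)%R
       (agl2_lin x * agl2_lin y).

Definition agl2_one : agl2 F := Agl2 0%R 1.

Definition agl2_inv x : agl2 F :=
  Agl2 (- (GLval (agl2_lin x)^-1 *m agl2_vec x))%R (agl2_lin x)^-1.

Lemma agl2_mulA : associative agl2_mul.
Proof.
move=> [a A] [b B] [c C]; congr Agl2; last exact: mulgA.
change (a + GLval A *m (b + GLval B *m c)
        = a + GLval A *m b + (GLval A *m GLval B) *m c)%R.
by rewrite mulmxDr addrA mulmxA.
Qed.

Lemma agl2_mul1 : left_id agl2_one agl2_mul.
Proof. by case=> a A; congr Agl2; [rewrite /= mul1mx add0r | exact: mul1g]. Qed.

Lemma agl2_mulV : left_inverse agl2_one agl2_inv agl2_mul.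
Proof. by case=> a A; congr Agl2; [rewrite /= addNr | exact: mulVg]. Qed.

HB.instance Definition _ :=
  Finite_isGroup.Build (agl2 F) agl2_mulA agl2_mul1 agl2_mulV.

(* The translations by vectors with both entries in K; for K the subfield of  *)
(* order q of a field F of order q ^ 2, this is the subgroup H_q.             *)
Definition subfield_translations (K : {set F}) : {set agl2 F} :=
  [set x : agl2 F | (agl2_lin x == 1)
                      && [forall i, agl2_vec x i ord0 \in K]].

End AGL2.

(* Main.v *)
(* H is a perfect code as soon as the right cosets of H have an inverse-closed
   transversal. A right coset in D = HgH and one in D^-1 = Hg^-1H always contain
   mutually inverse elements, so it suffices to pair the right cosets of D with
   those of D^-1. The two numbers of cosets agree, and when D = D^-1 that common
   number is even unless it is 1, because it divides the order of the 2-group H.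
   When it is 1, g normalises H and g^2 is in H, and the coset gH must contain
   an element of order at most 2. Thus only the g in N(H) matter in property Phi.

   For translations, g = (a, A) in N(H_q) has A over K = F_q. Write a = u + w v
   with u, v over K and w outside K: g^2 in H_q makes (I + A) a lie over K, hence
   (I + A) v = 0, and (u, I) is the required h. Property Phi itself fails for
   A = [1, w; 0, 1] and a = (0, w^-1), which lies outside N(H_q). *)
Require Import Defs.
From mathcomp Require Import all_boot all_order all_algebra all_fingroup.
From mathcomp Require Import all_solvable.

Set Implicit Arguments.
Unset Strict Implicit.
Unset Printing Implicit Defensive.

Import GRing.Theory.

Local Open Scope group_scope.

(** * Pairing elements along an involution of the fibres *)

(* Swaps 2i and 2i+1. *)
Definition flip k := if odd k then k.-1 else k.+1.

Lemma flipK : involutive flip.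
Proof.
rewrite /flip; case=> [|k] //=.
by case: (boolP (odd k)) => [|/negbTE] /= ok; rewrite ?ok.
Qed.

Lemma flip_neq k : flip k != k.
Proof.
by rewrite /flip; case: k => [|k] //=; case: ifP => _; rewrite neq_ltn leqnn ?orbT.
Qed.

(** For even [k], the successor is odd and so cannot equal the even bound [m]. *)
Lemma flip_lt k m : ~~ odd m -> k < m -> flip k < m.
Proof.
rewrite /flip => em lt_km; case: ifP => ok.
  by apply: leq_ltn_trans lt_km; exact: leq_pred.
rewrite ltn_neqAle lt_km andbT; apply: contra em => /eqP <-.
by rewrite /= ok.
Qed.

(** Fibres over distinct points exchanged by [iota] are matched by position in their enumerations; a
    self-paired fibre of even size is matched within itself by [flip]. Below, [X] holds the right
    cosets, [f] sends a coset to its double coset and [iota] is inversion. *)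
Lemma fiber_pairing (X Y : finType) (A : {set X}) (f : X -> Y) (iota : Y -> Y) :
    involutive iota ->
    {in A, forall x, #|[set y in A | f y == iota (f x)]|
                      = #|[set y in A | f y == f x]|} ->
    {in A, forall x, iota (f x) = f x -> odd #|[set y in A | f y == f x]| ->
                      #|[set y in A | f y == f x]| = 1%N} ->
  exists s : X -> X, {in A, forall x,
    [/\ s x \in A, s (s x) = x, f (s x) = iota (f x)
      & s x = x -> #|[set y in A | f y == f x]| = 1%N]}.
Proof.
move=> iotaK card_iota odd1.
pose e c := enum [set y in A | f y == c].
have size_e c : size (e c) = #|[set y in A | f y == c]| by rewrite -cardE.
pose j x := index x (e (f x)).
(* If a self-paired fibre is a singleton, flip runs past its end and nth returns
   the default x. *)
pose s x :=
  nth x (e (iota (f x))) (if iota (f x) == f x then flip (j x) else j x).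
have mem_e x c : (x \in e c) = (x \in A) && (f x == c) by rewrite mem_enum inE.
have lt_j x : x \in A -> j x < size (e (f x)) by rewrite index_mem mem_e eqxx andbT.
exists s => x Ax; have lt_jx := lt_j x Ax.
have nth_j : nth x (e (f x)) (j x) = x by rewrite nth_index // mem_e Ax eqxx.
have size_iota : size (e (iota (f x))) = size (e (f x)) by rewrite !size_e card_iota.
case: (eqVneq (iota (f x)) (f x)) => [fixf | nfixf]; last first.
  have def_s : s x = nth x (e (iota (f x))) (j x) by rewrite /s (negbTE nfixf).
  have : s x \in e (iota (f x)) by rewrite def_s mem_nth // size_iota.
  rewrite mem_e => /andP[As /eqP fs].
  have js : j (s x) = j x.
    by rewrite /j fs {1}def_s index_uniq ?enum_uniq // size_iota.
  split=> //; last by move=> sx; rewrite sx in fs; rewrite -fs eqxx in nfixf.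
  rewrite /s -/(s x) fs iotaK eq_sym (negbTE nfixf) js.
  (* The second application of [s] has default [s x] instead of [x]; the index is in range. *)
  by rewrite (set_nth_default x).
have def_s : s x = nth x (e (f x)) (flip (j x)) by rewrite /s fixf eqxx.
have [odd_f | even_f] := boolP (odd (size (e (f x)))).
  have size1 : size (e (f x)) = 1%N by rewrite size_e odd1 // -size_e.
  have sx : s x = x.
    by rewrite size1 in lt_jx; rewrite def_s nth_default // size1; case: (j x) lt_jx.
  by rewrite !sx; split=> //; rewrite -size_e.
have lt_f := flip_lt even_f lt_jx.
have : s x \in e (f x) by rewrite def_s mem_nth.
rewrite mem_e => /andP[As /eqP fs].
have js : j (s x) = flip (j x) by rewrite /j fs {1}def_s index_uniq ?enum_uniq.
split; rewrite ?fixf //.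
  by rewrite /s -/(s x) fs fixf eqxx js flipK (set_nth_default x).
by move=> sx; move: (flip_neq (j x)); rewrite -js sx eqxx.
Qed.

(** * Double cosets and inverse-closed transversals *)

Section DoubleCosets.

Variables (gT : finGroupType) (H : {group gT}).
Implicit Types (x y g : gT) (R : {set gT}).

Local Notation A := (rcosets H [set: gT]).
Local Notation fib R := [set R' in A | R' * H == R * H].

Lemma mem_rcosetsT x : H :* x \in A.
Proof. by apply/rcosetsP; exists x. Qed.

(** Right multiplication by [H] is transitive on the right cosets inside a double coset, so their
    number divides the order of [H]. *)
Lemma fiberE R : R \in A -> fib R = orbit 'Rs H R.
Proof.
case/rcosetsP=> x _ ->; apply/setP=> R'; rewrite inE; apply/andP/orbitP.
  case=> /rcosetsP[y _ ->] /eqP eqD.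
  have : y \in H :* x * H by rewrite -eqD -{1}[y]mulg1 mem_mulg ?rcoset_refl.
  case/mulsgP=> u h Hu Hh ->; exists h => //=.
  by rewrite -(rcoset_eqP Hu) rcosetM rcosetE.
case=> h Hh <- /=; rewrite rcosetE -rcosetM mem_rcosetsT; split=> //.
by rewrite rcosetM -mulgA lcoset_id.
Qed.

Lemma card_fiberM R : R \in A -> (#|fib R| * #|H|)%N = #|R * H|.
Proof.
move=> AR; symmetry; apply: card_uniform_partition.
  by move=> R'; rewrite inE => /andP[/rcosetsP[x _ ->] _]; rewrite card_rcoset.
have /and3P[_ tI n0] := rcosets_partition (subsetT H).
have sfA : fib R \subset A by apply/subsetP=> R'; rewrite inE => /andP[].
apply/and3P; split; last by apply: contra n0; apply: subsetP.
  rewrite fiberE // orbitRs /cover; apply/eqP/setP=> z.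
  apply/bigcupP/mulsgP => [[_ /rcosetsP[h Hh ->]] | [r h Rr Hh ->]].
    by rewrite mem_rcoset => Rz; exists (z * h^-1) h; rewrite // mulgKV.
  exists (R :* h); rewrite ?mem_rcoset ?mulgK //.
  by apply/rcosetsP; exists h.
exact: trivIsetS sfA tI.
Qed.

Lemma invg_double_coset x : (H :* x * H)^-1 = H :* x^-1 * H.
Proof. by rewrite !invMg invGid invg_set1 mulgA. Qed.

Hypothesis H2 : 2.-group H.
Hypothesis invH :
  {in 'N(H), forall g, g ^+ 2 \in H -> exists2 h, h \in H & (g * h) ^+ 2 = 1}.

Lemma involution_fixed_fiber R :
    R \in A -> (R * H)^-1 = R * H -> #|fib R| = 1%N ->
  exists2 x, x \in R & x^-1 = x.
Proof.
move=> AR; have [g _ defR] := rcosetsP AR.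
rewrite fiberE // orbitRs => invD /eqP/cards1P[R0 fR].
(* The orbit of [R] is a singleton. *)
have RHh h : h \in H -> R :* h = R.
  have fib_h k : k \in H -> R :* k = R0.
    by move=> Hk; apply/set1P; rewrite -fR; apply/rcosetsP; exists k.
  by move=> Hh; rewrite fib_h // -(fib_h 1) // mulg1.
have RH : R * H = R.
  apply/eqP; rewrite eqEsubset mulG_subl // andbT.
  apply/subsetP=> _ /mulsgP[r h Rr Hh ->].
  by rewrite -(RHh h Hh) mem_rcoset mulgK.
have Rg : g \in R by rewrite defR rcoset_refl.
have sgHR : g *: H \subset H :* g by rewrite -defR -RH mulSg ?sub1set.
have Ng : g \in 'N(H).
  rewrite -groupV inE; apply/subsetP=> _ /imsetP[h Hh ->].
  rewrite conjgE invgK mulgA -mem_rcoset; apply: (subsetP sgHR).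
  by rewrite mem_lcoset mulKg.
(* The double coset is just [R] and is closed under inversion, so both [g] and its inverse lie in
   [H :* g]. *)
have g2 : g ^+ 2 \in H.
  have : g^-1 \in R by rewrite -RH -invD memV_invg RH.
  by rewrite defR mem_rcoset -groupV invMg !invgK.
have [h Hh gh] := invH Ng g2; exists (g * h).
  by rewrite defR (subsetP sgHR) // mem_lcoset mulKg.
by apply/eqP; rewrite eq_invg_mul -gh expgS expg1.
Qed.

Lemma inverse_closed_transversal :
  exists t : {set gT} -> gT, {in A, forall R, t R \in R}
    /\ {in A, forall R, exists2 R', R' \in A & t R' = (t R)^-1}.
Proof.
have [||s sP] := @fiber_pairing _ _ A (fun R => R * H) (fun D => D^-1) (@set_invgK _).
- move=> R AR; have [x _ defR] := rcosetsP AR.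
  apply/eqP; rewrite -(eqn_pmul2r (cardG_gt0 H)) card_fiberM //.
  rewrite defR invg_double_coset card_fiberM ?mem_rcosetsT //.
  by rewrite -invg_double_coset card_invg.
- move=> R AR _; rewrite fiberE // => odd_f.
  have : 2.-nat #|orbit 'Rs H R| by apply: pnat_dvd H2; apply: dvdn_orbit.
  by case/p_natP=> k ek; move: odd_f; rewrite ek oddX /= orbF => /eqP ->.
have ex R : exists z,
    (R \in A) ==> [&& z \in R, z^-1 \in s R & (s R == R) ==> (z^-1 == z)].
  case: (boolP (R \in A)) => [AR | _]; last by exists 1.
  have [As ss fs s1] := sP R AR.
  have [sR | nsR] := eqVneq (s R) R.
    have [|z Rz zz] := involution_fixed_fiber AR _ (s1 sR); first by rewrite -fs sR.
    by exists z; rewrite sR zz Rz eqxx.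
  have [x _ defR] := rcosetsP AR; have [y _ defs] := rcosetsP As.
  have : y \in H :* x^-1 * H.
    rewrite -invg_double_coset -defR -fs defs -{1}[y]mulg1.
    by rewrite mem_mulg ?rcoset_refl.
  (* Here y = u k with u in H x^-1, so x^-1 k lies in H y, while its inverse k^-1 x lies in H x. *)
  case/mulsgP=> u k; rewrite mem_rcoset invgK => Hux Hk defy.
  exists (k^-1 * x).
  rewrite defs defR !mem_rcoset mulgK groupV Hk invMg invgK defy invMg /=.
  by rewrite !mulgA mulgK -invMg groupV Hux.
pose p R := xchoose (ex R).
have pP R : R \in A ->
    [/\ p R \in R, (p R)^-1 \in s R & s R = R -> (p R)^-1 = p R].
  move=> AR; have /implyP/(_ AR)/and3P[? ? /implyP pp] := xchooseP (ex R).
  by split=> // /eqP/pp/eqP.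
(* p R and p (s R) need not be mutually inverse, so one choice per pair is kept. *)
pose t R := if enum_rank R <= enum_rank (s R) then p R else (p (s R))^-1.
exists t; split=> R AR; have [As ss _ _] := sP R AR; have [pR pi p1] := pP R AR.
  by rewrite /t; case: ifP => // _; have [_] := pP _ As; rewrite ss.
exists (s R) => //; rewrite /t ss.
(* Equal ranks mean [s R = R], where [p R] is its own inverse. *)
case: ltngtP => [_|_|/ord_inj/enum_rank_inj sR]; rewrite ?invgK //.
by rewrite p1 sR.
Qed.

(** For v outside [H], the products c v^-1 with c in [H] fill the coset H v^-1, which contains
    exactly one element of the transversal. Discarding the elements of [H] from the transversal
    makes [H] a coclique. *)
Lemma group_perfect_code_2group : group_perfect_code H.
Proof.
have [t [tP tV]] := inverse_closed_transversal.
have tE R x : R \in A -> x \in R -> R = H :* x.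
  by case/rcosetsP=> y _ -> /rcoset_eqP ->.
exists [set x in t @: A | x \notin H]; split.
- by rewrite inE group1 andbF.
- move=> x; rewrite !inE groupV => /andP[/imsetP[R AR ->] ->]; rewrite andbT.
  by have [R' AR' <-] := tV R AR; apply: imset_f.
split=> [u v Hu Hv | v nHv].
  by rewrite /cayley inE (groupM Hv (groupVr Hu)) andbF.
exists (t (H :* v^-1) * v); split=> [|c [Hc]].
  have := tP _ (mem_rcosetsT v^-1); rewrite mem_rcoset invgK => Hc; split=> //.
  rewrite /cayley inE mulgK imset_f ?mem_rcosetsT //=.
  by apply: contra nHv => Ht; rewrite -(groupMl _ Ht).
rewrite /cayley inE => /andP[/imsetP[R AR def_c] _].
have RE := tE R _ AR (tP R AR).
by rewrite -(mulgKV v c) def_c {1}RE -def_c rcosetM (rcoset_id Hc).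
Qed.

End DoubleCosets.

(** * Translations over a subfield of index two *)

Section SubfieldTranslations.

Variables (F : finFieldType) (K : {set F}).
Hypotheses (K_subfield : GRing.divring_closed K) (char2 : (2%:R = 0 :> F)%R).
Hypotheses (gt1K : (1 < #|K|)%N) (cardF : #|F| = (#|K| ^ 2)%N).

Implicit Types (x y z : F) (a b u v : 'cV[F]_2) (A : {'GL_2[F]}).

Local Open Scope ring_scope.

Local Notation H := (subfield_translations K).
Local Notation overK v := (forall i, v i ord0 \in K).

Lemma subfield1 : 1 \in K. Proof. by case: K_subfield. Qed.

Lemma subfieldB x y : x \in K -> y \in K -> x - y \in K.
Proof. by case: K_subfield => _ KB _; apply: KB. Qed.

Lemma subfield_div x y : x \in K -> y \in K -> x / y \in K.
Proof. by case: K_subfield => _ _ Kdiv; apply: Kdiv. Qed.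

Lemma subfield0 : 0 \in K.
Proof. by rewrite -(subrr 1) subfieldB ?subfield1. Qed.

Lemma subfieldD x y : x \in K -> y \in K -> x + y \in K.
Proof. by move=> Kx Ky; rewrite -[y]opprK -[- y]sub0r !subfieldB ?subfield0. Qed.

Lemma subfieldM x y : x \in K -> y \in K -> x * y \in K.
Proof. by move=> Kx Ky; rewrite -[y]invrK -[y^-1]div1r !subfield_div ?subfield1. Qed.

Lemma addxx2 (V : lmodType F) (x : V) : x + x = 0.
Proof. by rewrite -mulr2n -scaler_nat char2 scale0r. Qed.

Lemma overKD u v : overK u -> overK v -> overK (u + v).
Proof. by move=> Ku Kv i; rewrite mxE subfieldD. Qed.

Lemma overKM (M : 'M[F]_2) v : (forall i j, M i j \in K) -> overK v -> overK (M *m v).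
Proof.
move=> KM Kv i; rewrite mxE.
by elim/big_ind: _ => [|x y|j _]; [apply: subfield0 | apply: subfieldD | rewrite subfieldM].
Qed.

Lemma subfield_translationsP (t : agl2 F) :
  reflect (agl2_lin t = 1%g /\ overK (agl2_vec t)) (t \in H).
Proof.
by rewrite inE; apply: (iffP andP) => [[/eqP ? /forallP] | [/eqP ? /forallP]].
Qed.

Lemma agl2_mulE a b A B : (Agl2 a A * Agl2 b B)%g = Agl2 (a + GLval A *m b) (A * B).
Proof. by []. Qed.

Lemma subfield_translations_group_set : group_set H.
Proof.
apply/group_setP; split.
  by apply/subfield_translationsP; split=> // i; rewrite mxE subfield0.
move=> [a A] [b B] /subfield_translationsP[/= -> Ka] /subfield_translationsP[/= -> Kb].
apply/subfield_translationsP; rewrite agl2_mulE mulg1 /= mul1mx; split=> //.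
exact: overKD.
Qed.

Canonical subfield_translations_group := Group subfield_translations_group_set.

(** By Cauchy, a prime divisor of the order is the order of some translation, and translations
    square to the identity in characteristic 2. *)
Lemma subfield_translations_2group : 2.-group H.
Proof.
apply/pnatP=> // p p_pr /(Cauchy p_pr)[[b B] /subfield_translationsP[/= -> Kb] order_p].
rewrite -[p \in _](dvdn_prime2 p_pr) // -order_p order_dvdn.
by rewrite expgS expg1 agl2_mulE mul1mx addxx2 mulg1.
Qed.

(** The map (u, v) -> u + w v is injective on K x K, since a collision with distinct v would make w
    a quotient in K; it is onto because |F| = |K|^2. *)
Lemma quadratic_basis :
  exists2 w, w \notin K & forall x, exists u v : F, [/\ u \in K, v \in K & x = u + w * v].
Proof.
have /subsetPn[w _ Kw] : ~~ ([set: F] \subset K).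
  apply/negP=> /subset_leq_card; rewrite cardsT cardF leqNgt.
  by rewrite -{1}[#|K|]expn1 ltn_exp2l.
exists w => // x.
pose f p := p.1 + w * p.2.
have injf : {in setX K K &, injective f}.
  move=> [u v] [u' v'] /setXP[/= Ku Kv] /setXP[/= Ku' Kv']; rewrite /f /= => eqf.
  have eqw : w * (v - v') = u' - u.
    by apply/eqP; rewrite mulrBr subr_eq addrAC -eqf addrC addKr.
  have [eqv | nv] := eqVneq v v'; last first.
    case/negP: Kw; have nz : v - v' != 0 by rewrite subr_eq0.
    rewrite -[w](mulfK nz) eqw.
    by rewrite subfield_div ?subfieldB.
  by move: eqf; rewrite eqv => /addIr ->.
have: x \in f @: setX K K.
  suff ->: f @: setX K K = [set: F] by rewrite inE.
  by apply/eqP; rewrite eqEcard subsetT card_in_imset // cardsX cardsT cardF mulnn leqnn.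
by case/imsetP=> [[u v] /setXP[/= Ku Kv] ->]; exists u, v.
Qed.

(** Conjugation carries the translation by the j-th basis vector to the translation by column j of
    [A]. *)
Lemma normaliser_lin a A i j : Agl2 a A \in 'N(H) -> GLval A i j \in K.
Proof.
rewrite -groupV inE => /subsetP nH.
pose t := Agl2 (delta_mx j ord0 : 'cV[F]_2) 1%g.
have Ht : t \in H.
  apply/subfield_translationsP; split=> //= k; rewrite mxE.
  by case: (_ && _); rewrite ?subfield1 ?subfield0.
have := nH (t ^ (Agl2 a A)^-1)%g; rewrite memJ_conjg => /(_ Ht).
set h := (t ^ _)%g => Hh.
have : (h * Agl2 a A = Agl2 a A * t)%g by rewrite /h conjgE invgK mulgA mulgKV.
case: h Hh => b B /subfield_translationsP[/= -> Kb].
rewrite !agl2_mulE mul1mx => [[]]; rewrite addrC => /addrI eqb _.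
by have := Kb i; rewrite eqb -colE mxE.
Qed.

Lemma normaliser_involution :
  {in 'N(H), forall g, g ^+ 2 \in H -> exists2 h, h \in H & (g * h) ^+ 2 = 1}%g.
Proof.
case=> a A NA; have KA i j := normaliser_lin i j NA.
rewrite expgS expg1 agl2_mulE => /subfield_translationsP[/= A2 Ka].
have [w Kw wP] := quadratic_basis.
have [u [v [Ku Kv defa]]] : exists u v, [/\ overK u, overK v & a = u + w *: v].
  have [[u0 [v0 [Ku0 Kv0 a0]]] [u1 [v1 [Ku1 Kv1 a1]]]] := (wP (a 0 0), wP (a 1 0)).
  exists (\col_i (if i == 0 then u0 else u1)), (\col_i (if i == 0 then v0 else v1)).
  split=> [i|i|]; try by rewrite mxE; case: ifP.
  apply/colP=> i; rewrite !mxE; case: (eqVneq i 0) => [-> // | ni].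
  by rewrite -a1; congr (a _ _); apply/val_inj; case: i ni => [[|[]]].
pose z := v + GLval A *m v.
have Kz : overK z by apply: overKD => //; apply: overKM.
have eqa : a + GLval A *m a = (u + GLval A *m u) + w *: z.
  by rewrite defa mulmxDr -scalemxAr scalerDr addrACA.
(* Since [w *: z] is over [K], a nonzero entry of [z] would put [w] in [K]. *)
have z0 : z = 0.
  apply/colP=> i; rewrite [RHS]mxE; apply: contraNeq Kw => nz.
  rewrite -[w](mulfK nz) subfield_div //.
  have := subfieldB (Ka i) (overKD Ku (overKM KA Ku) i).
  by rewrite eqa mxE [X in X - _]addrC addrK mxE.
exists (Agl2 u 1); first by apply/subfield_translationsP.
rewrite expgS expg1 !agl2_mulE mulg1 A2; congr Agl2.
rewrite mulmxDr addrACA eqa z0 scaler0 addr0.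
have -> : GLval A *m (GLval A *m u) = u.
  have AA : GLval A *m GLval A = 1%:M := congr1 (fun B => GLval B) A2.
  by rewrite mulmxA AA mul1mx.
by rewrite [GLval A *m u + u]addrC addxx2.
Qed.

Lemma subfield_translations_not_Phi : ~ Phi H.
Proof.
have [w Kw _] := quadratic_basis.
have nz_w : w != 0 by apply: contraNneq Kw => ->; apply: subfield0.
pose N : 'M[F]_2 := delta_mx 0 1.
have NN : N *m N = 0 by rewrite mul_delta_mx_cond mulr0n.
pose M := 1%:M + w *: N.
have MM : M *m M = 1%:M.
  rewrite mulmxDl mul1mx mulmxDr mulmx1 -scalemxAl -scalemxAr NN !scaler0 addr0.
  by rewrite -addrA addxx2 addr0.
have unitM : M \in unitmx by case: (mulmx1_unit MM).
pose A : {'GL_2[F]} := FinRing.Unit unitM.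
(* The factor w^-1 cancels the w in [M], so the square of (a, A) is the translation by the first
   basis vector. *)
pose a : 'cV[F]_2 := w^-1 *: delta_mx 1 0.
have MD u : M *m u = u + w *: (N *m u) by rewrite mulmxDl mul1mx -scalemxAl.
have AA : (A * A)%g = 1%g by apply/val_inj.
have sqr u : (Agl2 u A ^+ 2)%g = Agl2 (w *: (N *m u)) 1%g.
  rewrite expgS expg1 agl2_mulE AA; congr Agl2.
  by rewrite [GLval A]/= MD addrA addxx2 add0r.
case/(_ (Agl2 a A)) => [|[b B] /subfield_translationsP[/= -> Kb]].
  rewrite sqr; apply/subfield_translationsP; split=> // i.
  rewrite /= -scalemxAr mul_delta_mx scalerA divff // scale1r mxE.
  by case: (_ && _); rewrite ?subfield1 ?subfield0.
have NM : N *m M = N by rewrite mulmxDr mulmx1 -scalemxAr NN scaler0 addr0.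
have NE u : (N *m u) 0 0 = u 1 0.
  rewrite mxE 2!big_ord_recl big_ord0 !mxE /= mul0r add0r mul1r addr0.
  by congr (u _ _); apply/val_inj.
(* The square of g h is the translation by w N (a + b); its vanishing gives w^-1 = - b 1 0, which
   lies in [K]. *)
rewrite agl2_mulE mulg1 sqr => [[]] /eqP.
rewrite scaler_eq0 (negPf nz_w) mulmxDr mulmxA NM => /eqP/colP/(_ 0).
rewrite mxE !NE !mxE !eqxx mulr1 => /eqP; rewrite addr_eq0 => /eqP wb.
case/negP: Kw; rewrite -[w]invrK wb -div1r -sub0r.
by rewrite subfield_div ?subfieldB ?subfield0 ?subfield1.
Qed.

(** The scalar matrix w I has an entry outside [K], so it does not normalise [H]. *)
Lemma subfield_translations_not_normal : ~~ (H <| [set: agl2 F])%g.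
Proof.
have [w Kw _] := quadratic_basis.
have nz_w : w != 0 by apply: contraNneq Kw => ->; apply: subfield0.
have unitw : (w%:M : 'M[F]_2) \in unitmx by rewrite -scalemx1 unitmxZ ?unitmx1 ?unitfE.
apply: contra Kw => /andP[_ /subsetP nH].
have := normaliser_lin (a := 0) (A := FinRing.Unit unitw) ord0 ord0 (nH _ (in_setT _)).
by rewrite mxE.
Qed.

End SubfieldTranslations.

Theorem theorem1p3 (n q : nat) (n_ge1 : (1 <= n)%N) (def_q : q = (2 ^ n)%N)
    (F : finFieldType) (cardF : #|F| = (q ^ 2)%N)
    (K : {set F}) (K_subfield : GRing.divring_closed K)
    (cardK : #|K| = q) :
  [/\ group_set (subfield_translations K),
      ~~ (subfield_translations K <| [set: agl2 F])%g,
      group_perfect_code (subfield_translations K)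
    & ~ Phi (subfield_translations K)].
Proof.
have gt1K : 1 < #|K| by rewrite cardK def_q -{1}(expn0 2) ltn_exp2l.
have char2 : (2%:R = 0 :> F)%R.
  (* Lagrange in the additive group of [F] kills |F| times 1, and |F| is a power of 2. *)
  have : (#|F|%:R = 0 :> F)%R by rewrite -FinRing.zmodXgE -cardsT expg_cardG ?inE.
  rewrite cardF def_q -expnM natrX => /eqP; rewrite expf_eq0 => /andP[_ /eqP //].
rewrite -cardK in cardF.
split.
- exact: subfield_translations_group_set.
- exact: subfield_translations_not_normal.
- apply: (group_perfect_code_2group (H := subfield_translations_group K_subfield)).
    exact: subfield_translations_2group.
  exact: normaliser_involution.
- exact: subfield_translations_not_Phi.
Qed.
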